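(* Let $\mathbb{D}$ and $\mathbb{M}$ be two composable classes of filters containing principal filters and let $\mathbb{J}$ and $\mathbb{K}$ be two $\mathbb{D}$-composable classes of filters. Let $X$ be a convergence space, $\mathcal{F}\in\mathbb{K}(X)$ and $A\subset X$. The following are equivalent: (1) $\mathcal{F}$ is an $\mathbb{M}$-compactly $(\mathbb{J}/\mathbb{D})_{\#}$-filter at $A$; (2) for every convergence space $Y$, every $B\subset Y$ and every $(\mathbb{K}/\mathbb{J})_{\#\geq}$-filter $\mathcal{G}$ on $Y$ which is a compactly $(\mathbb{D}/\mathbb{M})_{\#}$-filter at $B$, the filter $\mathcal{F}\times\mathcal{G}$ is an $\mathbb{M}$-compactly $(\mathbb{D}/\mathbb{D}\times\mathbb{M})_{\#}$-filter at $A\times B$; (3) for every $(\mathbb{D}/\mathbb{M})$-accessible convergence space $Y$, every $B\subset Y$ and every $\mathbb{J}$-filter $\mathcal{G}$ on $Y$ which is $\mathbb{D}$-compact at $B$, the filter $\mathcal{F}\times\mathcal{G}$ is $(\mathbb{D}\cap\mathbb{M})$-compact at $A\times B$; (4) for every $\mathbb{M}$-based convergence space $Y$ and $y\in Y$, and for every $\mathbb{J}$-filter $\mathcal{G}$ on $Y$ which is $\mathbb{D}$-compact at $\{y\}$, the filter $\mathcal{F}\times\mathcal{G}$ is $\mathbb{F}_1$-compact at $A\times\{y\}$; (5) for every $\mathbb{M}$-based (possibly non-Hausdorff) topological space $Y$ and $B\subset Y$, and for every $\mathbb{J}$-filter $\mathcal{G}$ on $Y$ which is $\mathbb{D}$-compact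 at $B$, the filter $\mathcal{F}\times\mathcal{G}$ is $\mathbb{F}_1$-compact at $A\times B$.
   Context: Filters are ordered by inclusion ($\mathcal{G}\ge\mathcal{F}$, ''$\mathcal{G}$ is finer than $\mathcal{F}$'', iff $\mathcal{F}\subset\mathcal{G}$). A convergence $\xi$ on a set $X$ is a relation between points of $X$ and (proper) filters on $X$, written $x\in\lim_\xi\mathcal{F}$, such that $\lim\mathcal{F}\subset\lim\mathcal{G}$ if $\mathcal{F}\le\mathcal{G}$, $x\in\lim\{x\}^{\uparrow}$ for all $x$, and $\lim\mathcal{F}\cap\lim\mathcal{G}\subset\lim(\mathcal{F}\wedge\mathcal{G})$ (where $\mathcal F\wedge\mathcal G=\mathcal F\cap\mathcal G$). Topological spaces are regarded as convergence spaces. Products carry the product convergence. Families $\mathcal{A},\mathcal{B}$ of subsets mesh, $\mathcal{A}\#\mathcal{B}$, if $A\cap B\ne\varnothing$ for all $A\in\mathcal{A}$, $B\in\mathcal{B}$. The adherence $\mathrm{adh}\,\mathcal{D}$ is the union of the limit sets of all filters finer than $\mathcal{D}$. A class of filters $\mathbb{D}$ assigns to each set $X$ a set $\mathbb{D}(X)$ of filters on $X$ (its members are ''$\mathbb{D}$-filters''); by convention each class also contains the degenerate filter, while filters in the definitions below are proper. $\mathbb{F}$ is the class of all filters, $\mathbb{F}_1$ the class of principal filters. A filter $\mathcal{F}$ on a convergence space $X$ is $\mathbb{D}$-compact at $A\subset X$ if $\mathcal{D}\in\mathbb{D}(X)$ and $\mathcal{D}\#\mathcal{F}$ imply $\mathrm{adh}\,\mathcal{D}\cap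 A\neq\varnothing$. For a filter $\mathcal{H}$ on $X\times Y$ and $\mathcal{F}$ on $X$, $\mathcal{H}(\mathcal{F})$ is the (possibly degenerate) filter on $Y$ generated by the sets $HF=\{y:(x,y)\in H\text{ for some }x\in F\}$, $H\in\mathcal{H}$, $F\in\mathcal{F}$. A class $\mathbb{J}$ is $\mathbb{D}$-composable if $\mathcal{H}(\mathcal{F})\in\mathbb{J}(Y)$ for all $X,Y$, $\mathcal{F}\in\mathbb{J}(X)$, $\mathcal{H}\in\mathbb{D}(X\times Y)$; $\mathbb{D}$ is composable if it is $\mathbb{D}$-composable. $\mathcal{F}\times\mathcal{G}$ is the filter generated by $\{F\times G:F\in\mathcal{F},G\in\mathcal{G}\}$; $\mathbb{D}\times\mathbb{M}$ is the class of filters $\mathcal{D}\times\mathcal{M}$ on products $X\times Y$ with $\mathcal{D}\in\mathbb{D}(X)$, $\mathcal{M}\in\mathbb{M}(Y)$. $\mathcal{F}$ is an $\mathbb{M}$-compactly $(\mathbb{J}/\mathbb{D})_{\#}$-filter at $A$ if for every $\mathcal{J}\in\mathbb{J}$ with $\mathcal{J}\#\mathcal{F}$ there is $\mathcal{D}\in\mathbb{D}$ with $\mathcal{D}\#\mathcal{J}$ and $\mathcal{D}$ $\mathbb{M}$-compact at $A$; ''compactly'' without prefix means $\mathbb{F}$-compactly. $\mathcal{G}$ is a $(\mathbb{K}/\mathbb{J})_{\#\ge}$-filter if for every $\mathcal{K}\in\mathbb{K}$ with $\mathcal{K}\#\mathcal{G}$ there is $\mathcal{J}\in\mathbb{J}$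 with $\mathcal{J}\#\mathcal{K}$ and $\mathcal{J}\ge\mathcal{G}$. A convergence space is $\mathbb{D}$-based if whenever $x\in\lim\mathcal{F}$ there is $\mathcal{D}\in\mathbb{D}$, $\mathcal{D}\le\mathcal{F}$, with $x\in\lim\mathcal{D}$. It is $(\mathbb{J}/\mathbb{D})$-accessible if whenever $x\in\mathrm{adh}\,\mathcal{J}$ with $\mathcal{J}\in\mathbb{J}$ there is $\mathcal{D}\in\mathbb{D}$ with $x\in\lim\mathcal{D}$ and $\mathcal{D}\#\mathcal{J}$. *)

(* Defs.v *)
From HB Require Import structures.
From mathcomp Require Import all_boot all_classical topology.
Set Implicit Arguments.
Unset Strict Implicit.
Unset Printing Implicit Defensive.

Local Open Scope classical_set_scope.

(* A filter G is finer than F, i.e. F <= G, when F `<=` G as families of sets,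
   and the infimum of F and G is F `&` G. Two families mesh when F `#` G. *)

Record convergence (X : Type) := Convergence {
  clim :> set_system X -> set X ;
  clim_proper : forall F x, clim F x -> ProperFilter F ;
  clim_finer : forall F G, ProperFilter F -> ProperFilter G ->
    F `<=` G -> clim F `<=` clim G ;
  clim_point : forall x, clim (principal_filter x) x ;
  clim_meet : forall F G, clim F `&` clim G `<=` clim (F `&` G) }.

Definition adh (X : Type) (xi : convergence X) (D : set_system X) : set X :=
  \bigcup_(G in [set G | ProperFilter G /\ D `<=` G]) xi G.

Section ProductConvergence.
Variables (X Y : Type) (xi : convergence X) (tau : convergence Y).

Definition prod_clim (H : set_system (X * Y)) : set (X * Y) :=
  [set p | ProperFilter H /\ xi (fst @ H) p.1 /\ tau (snd @ H) p.2].

Lemma prod_clim_proper H p : prod_clim H p -> ProperFilter H.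
Proof. by case. Qed.

Lemma prod_clim_finer F G : ProperFilter F -> ProperFilter G ->
  F `<=` G -> prod_clim F `<=` prod_clim G.
Proof.
move=> PF PG FG p [_ [h1 h2]]; split=> //; split.
- by apply: clim_finer h1 => // A; apply: FG.
- by apply: clim_finer h2 => // A; apply: FG.
Qed.

Lemma prod_clim_point p : prod_clim (principal_filter p) p.
Proof.
have Pp := principal_filter_proper p; split=> //.
by split; (apply: clim_finer (clim_point _ _);
  [exact: principal_filter_proper | move=> A Ap x /= ->; apply: Ap]).
Qed.

Lemma prod_clim_meet F G : prod_clim F `&` prod_clim G `<=` prod_clim (F `&` G).
Proof.
move=> p [[PF [hF1 hF2]] [PG [hG1 hG2]]]; split; last first.
  split.
  - exact: (@clim_meet _ xi (fst @ F) (fst @ G) _ (conj hF1 hG1)).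
  - exact: (@clim_meet _ tau (snd @ F) (snd @ G) _ (conj hF2 hG2)).
split; first by case=> /filter_not_empty.
split; first by split; exact: filterT.
- by move=> A B [FA GA] [FB GB]; split; exact: filterI.
- by move=> A B AB [FA GA]; split; exact: filterS AB _.
Qed.

Definition prod_convergence : convergence (X * Y) :=
  Convergence prod_clim_proper prod_clim_finer prod_clim_point prod_clim_meet.

End ProductConvergence.

Section TopologicalConvergence.
Variable Y : topologicalType.

Definition top_clim (F : set_system Y) : set Y :=
  [set y | ProperFilter F /\ F --> y].

Lemma top_clim_proper F y : top_clim F y -> ProperFilter F.
Proof. by case. Qed.

Lemma top_clim_finer F G : ProperFilter F -> ProperFilter G ->
  F `<=` G -> top_clim F `<=` top_clim G.
Proof. by move=> _ PG FG y [_ Fy]; split=> // A /Fy; apply: FG. Qed.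

Lemma top_clim_point y : top_clim (principal_filter y) y.
Proof.
split; first exact: principal_filter_proper.
by move=> A /nbhs_singleton Ay _ ->.
Qed.

Lemma top_clim_meet F G : top_clim F `&` top_clim G `<=` top_clim (F `&` G).
Proof.
move=> y [[PF Fy] [PG Gy]]; split; last first.
  by move=> A Ay; split; [exact: Fy|exact: Gy].
split; first by case=> /filter_not_empty.
split; first by split; exact: filterT.
- by move=> A B [FA GA] [FB GB]; split; exact: filterI.
- by move=> A B AB [FA GA]; split; exact: filterS AB _.
Qed.

Definition top_convergence : convergence Y :=
  Convergence top_clim_proper top_clim_finer top_clim_point top_clim_meet.

End TopologicalConvergence.

(* The degenerate filter setT is a member of every class. Properness is not
   imposed on the filters of the definitions below: a filter that meshes with
   another one is proper, so a degenerate filter only satisfies them vacuously. *)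
Record filterClass := FilterClass {
  fclass :> forall X : Type, set (set_system X) ;
  fclass_filter : forall X (F : set_system X), fclass F -> Filter F ;
  fclass_degenerate : forall X : Type, fclass [set: set X] }.

Definition all_filters (X : Type) : set (set_system X) :=
  [set F | Filter F].

Definition principal_filters (X : Type) : set (set_system X) :=
  range (@globally X).

Definition rel_image (X Y : Type) (H : set (X * Y)) (F : set X) : set Y :=
  [set y | exists2 x, F x & H (x, y)].

Definition filter_rel_image (X Y : Type) (H : set_system (X * Y))
    (F : set_system X) : set_system Y :=
  filter_from [set P | H P.1 /\ F P.2] (fun P => rel_image P.1 P.2).

(* J is D-composable. *)
Definition composable (D J : filterClass) : Prop :=
  forall (X Y : Type) (F : set_system X) (H : set_system (X * Y)),
    J X F -> D (X * Y)%type H -> J Y (filter_rel_image H F).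

Definition contains_principal (D : filterClass) : Prop :=
  forall X : Type, @principal_filters X `<=` D X.

(* The class of products of filters is only needed on a product set with given
   factors, so the definitions below take, instead of a class of filters, its
   set of filters on the space at hand. *)
Definition product_filters (X Y : Type) (D : set (set_system X))
    (M : set (set_system Y)) : set (set_system (X * Y)) :=
  [set filter_prod F G | F in D & G in M].

Section FilterProperties.
Variables (X : Type) (xi : convergence X).
Implicit Types (D J K M : set (set_system X)) (F G : set_system X) (A : set X).

Definition compact_at D F A : Prop :=
  forall E, D E -> E `#` F -> adh xi E `&` A !=set0.

(* F is an M-compactly (J/D)_# filter at A. *)
Definition compactly_mesh M J D F A : Prop :=
  forall E, J E -> E `#` F ->
    exists C, [/\ D C, C `#` E & compact_at M C A].

(* G is a (K/J)_#>= filter. *)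
Definition mesh_finer K J G : Prop :=
  forall E, K E -> E `#` G -> exists C, [/\ J C, C `#` E & G `<=` C].

Definition based D : Prop :=
  forall F x, xi F x -> exists C, [/\ D C, C `<=` F & xi C x].

Definition accessible J D : Prop :=
  forall E x, J E -> adh xi E x -> exists C, [/\ D C, xi C x & C `#` E].

End FilterProperties.

(* Main.v *)
Require Import Defs.
From HB Require Import structures.
From mathcomp Require Import all_boot all_classical topology.

Set Implicit Arguments.
Unset Strict Implicit.
Unset Printing Implicit Defensive.

Local Open Scope classical_set_scope.

(** Everything rests on one exchange rule, [meets_filter_rel_image]: for a
    filter [H] on a product, [H] meshes with [F x G] iff [H(F)] meshes with
    [G], iff [H^-1(G)] meshes with [F].  Composability keeps the filters so
    obtained in the classes at hand.

    (1) implies (2).  Let [E] be a [D]-filter meshing with [F x G].  The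
    hypothesis on [G] replaces it by a finer [J]-filter [I] that meshes with
    [E(F)].  Then [E^-1(I)] is a [J]-filter meshing with [F], so (1) provides
    an [M]-compact [D]-filter [C] meshing with it; and [E(C)] is a [D]-filter
    meshing with [G], which provides a compact [M]-filter [N] meshing with it.
    So [C x N] meshes with [E], and it is [M]-compact by the same exchange
    ([compact_at_prod]).  This is [compactly_mesh_prod].

    (2) implies (3).  A [J]-filter is its own finer [J]-filter; in a
    [(D/M)]-accessible space a [D]-compact filter is a compactly
    [(D/M)_#]-filter, because a filter with a limit in [B] is compact at [B]
    ([adherent_compactly_mesh]); and an [M]-compactly [(D/C)_#]-filter, for any
    [C], is [(D n M)]-compact ([compactly_mesh_compact]).  Based spaces
    are accessible, so (3) gives (4), and (1) gives (5) through (2).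

    Back to (1).  Suppose (1) fails, for a [J]-filter [I] meshing with [F]:
    each [D]-filter meshing with [I] meshes with some [M]-filter whose
    adherence misses [A] (a remote filter).  Add to [X] new points at which
    exactly the remote filters are made to converge.  Then [I] is [D]-compact
    at the set [B] of new points, while the graph of the inclusion meshes with
    [F x I] and has no adherence point in [A x B], since the first component
    of such a point would be adherent to a remote filter
    ([compactly_mesh_of_test]).  With one new point this is a convergence
    space, which is [M]-based since [M] is stable under finite infima
    ([collapse], for (4)); with one new point per remote filter it is a
    topological space ([fan], for (5)). *)

(** * Meshing filters and relations *)

Lemma meets_sup (X : Type) (F G : set_system X) : Filter F -> Filter G ->
  F `#` G -> exists H, [/\ ProperFilter H, F `<=` H & G `<=` H].
Proof.
move=> FF FG FmG.
exists (filter_from [set P | F P.1 /\ G P.2] (fun P => P.1 `&` P.2)); split.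
- apply: filter_from_proper; last by move=> P [F1 G2]; exact: FmG.
  apply: filter_from_filter; first by exists (setT, setT); split; exact: filterT.
  move=> P Q [FP GP] [FQ GQ]; exists (P.1 `&` Q.1, P.2 `&` Q.2).
    by split; exact: filterI.
  by move=> x [[? ?] [? ?]].
- by move=> S FS; exists (S, setT) => [|x []//]; split=> //; exact: filterT.
- by move=> S GS; exists (setT, S) => [|x []//]; split=> //; exact: filterT.
Qed.

Lemma meets_finer (X : Type) (F G : set_system X) : ProperFilter G ->
  F `<=` G -> G `#` F.
Proof. by move=> PG FG; apply: sub_meets FG (proper_meetsxx PG). Qed.

(** Both sides say that every box [f x g] meets every [h]: a point [y] of [g]
    lies in [h(f)] exactly when some [(x, y)] with [x] in [f] lies in [h]. *)
Lemma meets_filter_rel_image (X Y : Type) (H : set_system (X * Y))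
    (F : set_system X) (G : set_system Y) :
  (filter_rel_image H F `#` G) <-> (H `#` filter_prod F G).
Proof.
split=> [HFG h S Hh [P [FP GP] PS]|HFG S g [[h f] [/= Hh Ff] hfS] Gg].
- have [|y [[x Px hxy] Py]] := HFG (rel_image h P.1) P.2 _ GP.
    by exists (h, P.1).
  by exists (x, y); split=> //; exact: PS.
- have [|[x y] [hxy [fx gy]]] := HFG h (f `*` g) Hh; first by exists (f, g).
  by exists y; split=> //; apply: hfS; exists x.
Qed.

Lemma meets_filter_prod_swap (X Y : Type) (H : set_system (X * Y))
    (F : set_system X) (G : set_system Y) :
  (H `#` filter_prod F G) -> (swap_pair @ H) `#` filter_prod G F.
Proof.
move=> HFG S T HS [P [GP FP] PT].
have [|[x y] [hxy [fx gy]]] := HFG _ (P.2 `*` P.1) HS; first by exists (P.2, P.1).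
by exists (y, x); split=> //; exact: PT.
Qed.

Lemma meets_filter_rel_image_swap (X Y : Type) (H : set_system (X * Y))
    (F : set_system X) (G : set_system Y) : Filter H ->
  (filter_rel_image (swap_pair @ H) G `#` F) <-> (H `#` filter_prod F G).
Proof.
move=> FH; split=> [/meets_filter_rel_image/meets_filter_prod_swap HFG|]; last first.
  by move=> /meets_filter_prod_swap/meets_filter_rel_image.
apply: meetsSl HFG => S HS; by apply: (@filterS _ H _ S) HS => -[].
Qed.

(** * Composable classes *)

Section Composable.
Variable M : filterClass.
Hypothesis M_princ : contains_principal M.

Lemma class_globally (X : Type) (S : set X) : M X (globally S).
Proof. by apply: M_princ; exists S. Qed.

(** The image under a function is the image under the principal filter of its
    graph. *)
Lemma class_fmap (L : filterClass) (X Y : Type) (f : X -> Y) (F : set_system X) :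
  composable M L -> L X F -> L Y (f @ F).
Proof.
move=> ML LF; have FF := fclass_filter LF.
suff -> : f @ F = filter_rel_image (globally [set p | p.2 = f p.1]) F.
  exact: ML LF (class_globally _).
apply/seteqP; split=> [S FS|S [[h g] [/= hS Fg] hgS]].
  exists ([set p | p.2 = f p.1], f @^-1` S); first by split.
  by move=> y [x /= Sx ->].
by apply: filterS Fg => x gx; apply: hgS; exists x => //; exact: hS.
Qed.

Hypothesis M_comp : composable M M.

Lemma class_rel_image_swap (L : filterClass) (X Y : Type)
    (H : set_system (X * Y)) (G : set_system Y) :
  composable M L -> M (X * Y)%type H -> L Y G ->
  L X (filter_rel_image (swap_pair @ H) G).
Proof. by move=> ML MH LG; apply: ML LG _; exact: class_fmap. Qed.

(** The infimum is the image of [G] under the filter of relations generated by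
    the sets [{(y, z) : z = y or z \in f}], [f \in F]: the image of a nonempty
    [g] is [g u f].  That filter of relations is itself the image of [F] under
    the relation [R] below.  An empty [f] or [g] would lose the other set,
    hence the separate treatment of the degenerate filter. *)
Lemma class_meet (X : Type) (F G : set_system X) :
  M X F -> M X G -> M X (F `&` G).
Proof.
move=> MF MG; have FF := fclass_filter MF; have FG := fclass_filter MG.
have [F0|F0] := pselect (F set0).
  suff -> : F `&` G = G by [].
  by apply/seteqP; split=> [S []//|S GS]; split=> //; apply: filterS F0.
have [G0|G0] := pselect (G set0).
  suff -> : F `&` G = F by [].
  by apply/seteqP; split=> [S []//|S FS]; split=> //; apply: filterS G0.
pose R : set (X * (X * X)) := [set p | p.2.2 = p.2.1 \/ p.2.2 = p.1].
pose H := filter_rel_image (globally R) F.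
have MH : M (X * X)%type H by exact: M_comp MF (class_globally _).
suff -> : F `&` G = filter_rel_image H G by exact: M_comp.
have ne (T : set_system X) S : Filter T -> ~ T set0 -> T S -> S !=set0.
  by move=> _ T0 TS; apply/set0P/eqP => S0; apply: T0; rewrite -S0.
apply/seteqP; split=> [S [FS GS]|S [[h g] [/= [[r f] [/= Rr Ff] rfh] Gg] hgS]].
  exists (rel_image R S, S) => /=; first by split=> //; exists (R, S) => //; split.
  by move=> z [y Sy [x Sx]]; rewrite /R /= => -[->|->].
have [x fx] := ne _ _ FF F0 Ff; have [y gy] := ne _ _ FG G0 Gg.
split.
- apply: filterS Ff => z fz; apply: hgS; exists y => //.
  by apply: rfh; exists z => //; apply: Rr; right.
- apply: filterS Gg => z gz; apply: hgS; exists z => //.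
  by apply: rfh; exists x => //; apply: Rr; left.
Qed.

End Composable.

(** * Adherence and compactness *)

Section Adherence.
Variables (X : Type) (xi : convergence X).

Lemma lim_meets_adh (E C : set_system X) (x : X) : Filter E ->
  xi C x -> C `#` E -> adh xi E x.
Proof.
move=> FE Cx CE; have PC := clim_proper Cx.
have [H [PH CH EH]] := meets_sup _ _ CE.
by exists H => //; exact: clim_finer Cx.
Qed.

(** A filter finer than [E n C] meshes with [E] or with [C]: otherwise it
    contains the complements of some [e] and of some [c], although it contains
    [e u c]. *)
Lemma adh_meet (E C : set_system X) : Filter E -> Filter C ->
  adh xi (E `&` C) `<=` adh xi E `|` adh xi C.
Proof.
move=> FE FC x [G [PG ECG] Gx]; apply: contrapT => /not_orP[nE nC].
have : ~ (G `#` E) by move=> /(lim_meets_adh FE Gx).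
have : ~ (G `#` C) by move=> /(lim_meets_adh FC Gx).
rewrite /meets.
move=> /existsNP[g1] /existsNP[c] /not_implyP[Gg1] /not_implyP[Cc] g1c.
move=> /existsNP[g2] /existsNP[e] /not_implyP[Gg2] /not_implyP[Ee] g2e.
have Gec : G (e `|` c).
  by apply: ECG; split; [apply: filterS Ee | apply: filterS Cc] => z; [left|right].
have [z [[g1z g2z] [ez|cz]]] := filter_ex (filterI (filterI Gg1 Gg2) Gec).
- by apply: g2e; exists z.
- by apply: g1c; exists z.
Qed.

Lemma based_accessible (D M : filterClass) :
  based xi (M X) -> accessible xi (D X) (M X).
Proof.
move=> bM E x DE [G [PG EG] Gx]; have [C [MC CG Cx]] := bM _ _ Gx.
by exists C; split=> //; apply: sub_meets CG EG (proper_meetsxx PG).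
Qed.

(** A filter [C] converging to [x] in [B] is compact at [B], because every
    filter meshing with [C] has [x] as an adherence point. *)
Lemma adherent_compactly_mesh (D M : filterClass) (G : set_system X)
    (B : set X) : accessible xi (D X) (M X) ->
  compact_at xi (D X) G B ->
  compactly_mesh xi (@all_filters X) (D X) (M X) G B.
Proof.
move=> acc Gc E DE EG; have [x [Ex Bx]] := Gc _ DE EG.
have [C [MC Cx CE]] := acc _ _ DE Ex.
exists C; split=> // H FH HC; exists x; split=> //.
by apply: lim_meets_adh Cx _ => //; rewrite meetsC.
Qed.

Lemma mesh_finer_self (K J : set (set_system X)) (G : set_system X) :
  J G -> mesh_finer K J G.
Proof. by move=> JG E _ EG; exists G; split=> //; rewrite meetsC. Qed.

(** The filter [C] obtained from [E] can be tested against [E] itself. *)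
Lemma compactly_mesh_compact (M D C : set (set_system X)) (F : set_system X)
    (A : set X) :
  compactly_mesh xi M D C F A -> compact_at xi (D `&` M) F A.
Proof.
move=> Fc E [DE ME] EF; have [H [_ HE]] := Fc E DE EF.
by apply; rewrite // meetsC.
Qed.

End Adherence.

Section Products.
Variables (X Y : Type) (xi : convergence X) (tau : convergence Y).

(** [W x V] converges to [(x, y)], and so does its supremum with [E]. *)
Lemma adh_prod (E : set_system (X * Y)) (W : set_system X) (V : set_system Y)
    (x : X) (y : Y) : Filter E -> xi W x -> tau V y ->
  E `#` filter_prod W V -> adh (prod_convergence xi tau) E (x, y).
Proof.
move=> FE Wx Vy EWV; have PW := clim_proper Wx; have PV := clim_proper Vy.
have [H [PH EH WVH]] := meets_sup _ _ EWV.
exists H => //; split=> //; split=> /=.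
- apply: clim_finer Wx => S WS; apply: WVH.
  by exists (S, setT) => [|[? ?] []//]; split=> //; exact: filterT.
- apply: clim_finer Vy => S VS; apply: WVH.
  by exists (setT, S) => [|[? ?] []//]; split=> //; exact: filterT.
Qed.

(** An [M]-filter [E] meshing with [C x N] is pulled back along [N] to an
    [M]-filter on [X], which has a limit point [x] in [A] through some finer
    [W]; then [E(W)] meshes with [N].  It need not be an [M]-filter, so [N]
    has to be compact with respect to all filters. *)
Lemma compact_at_prod (M : filterClass) (C : set_system X) (N : set_system Y)
    (A : set X) (B : set Y) :
  composable M M -> contains_principal M -> M Y N ->
  compact_at xi (M X) C A -> compact_at tau (@all_filters Y) N B ->
  compact_at (prod_convergence xi tau) (M (X * Y)%type)
    (filter_prod C N) (A `*` B).
Proof.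
move=> Mc Mp MN Cc Nc E ME ECN; have FE := fclass_filter ME.
have [|x [[W [PW EW] Wx] Ax]] := Cc _ (class_rel_image_swap Mp Mc Mc ME MN).
  exact/meets_filter_rel_image_swap.
have EWN : E `#` filter_prod W N.
  by apply/meets_filter_rel_image_swap; rewrite meetsC; exact: meets_finer.
have [||y [[V [PV EV] Vy] By]] := Nc (filter_rel_image E W).
- apply: filter_from_filter; first by exists (setT, setT); split; exact: filterT.
  move=> P Q [? ?] [? ?]; exists (P.1 `&` Q.1, P.2 `&` Q.2).
    by split; exact: filterI.
  by move=> z [u [? ?] [? ?]]; split; exists u.
- exact/meets_filter_rel_image.
exists (x, y); split=> //; apply: adh_prod Wx Vy _.
by apply/meets_filter_rel_image; rewrite meetsC; exact: meets_finer.
Qed.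

End Products.

(** * Test spaces *)

Section TestSpaces.
Variables (D M J : filterClass).
Hypotheses (D_comp : composable D D) (M_comp : composable M M).
Hypotheses (D_princ : contains_principal D) (M_princ : contains_principal M).
Hypothesis J_comp : composable D J.
Variables (X : Type) (xi : convergence X) (F : set_system X) (A : set X).

(** The filters witnessing that some filter is not [M]-compact at [A]. *)
Definition remote (N : set_system X) : Prop :=
  M X N /\ ~ (adh xi N `&` A !=set0).

(** [Y] is a test space when, through [e], every remote filter converges to a
    point of [B] and only filters finer than a remote one do.  By the first
    property the image of a filter violating the conclusion would be
    [D]-compact at [B]; by the second the graph of [e] has no adherence point
    in [A x B]. *)
Lemma compactly_mesh_of_test (Y : Type) (tau : convergence Y) (B : set Y)
    (e : X -> Y) :
  (forall N, ProperFilter N -> remote N -> exists2 y, B y & tau (e @ N) y) ->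
  (forall W y, ProperFilter W -> B y -> tau (e @ W) y ->
    exists2 N, remote N & N `<=` W) ->
  (forall G, J Y G -> compact_at tau (D Y) G B ->
    compact_at (prod_convergence xi tau) (@principal_filters (X * Y))
      (filter_prod F G) (A `*` B)) ->
  compactly_mesh xi (M X) (J X) (D X) F A.
Proof.
move=> limN limW prodc I JI IF; apply: contrapT => noC.
have FI := fclass_filter JI.
have ec : compact_at tau (D Y) (e @ I) B.
  move=> E DE EI; have FE := fclass_filter DE.
  pose C := filter_rel_image (globally [set p | p.1 = e p.2]) E.
  have DC : D X C by exact: D_comp DE (class_globally D_princ _).
  have CI : C `#` I.
    apply/meets_filter_rel_image => h S hS [P [EP1 IP2] PS].
    have [|y [P1y [x P2x exy]]] := EI P.1 (e @` P.2) EP1.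
      by apply: (@filterS _ I _ P.2) IP2 => x P2x; exists x.
    by exists (e x, x); split; [exact: hS | apply: PS; split=> //=; rewrite exy].
  apply: contrapT => nadh; apply: noC; exists C; split=> // N MN NC.
  apply: contrapT => farN; have FN := fclass_filter MN.
  have PN : ProperFilter N.
    split=> // N0; have [|x [[]]//] := NC set0 setT N0.
    by exists (setT, setT) => //; split; exact: filterT.
  have [y By Ny] := limN N PN (conj MN farN).
  apply: nadh; exists y; split=> //; apply: lim_meets_adh Ny _.
  move=> S T NS ET.
  have [|x [Sx [y' Ty' y'x]]] := NC (e @^-1` S) (rel_image [set p | p.1 = e p.2] T) NS.
    by exists ([set p | p.1 = e p.2], T); first by split.
  by exists (e x); split=> //; rewrite -y'x.
have JeI : J Y (e @ I) by apply: class_fmap J_comp _.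
pose graph : set (X * Y) := [set p | p.2 = e p.1].
have [|| [x y] [[H [PH gH] [_ [/= Hx Hy]]] [/= Ax By]]] :=
  prodc _ JeI ec (globally graph).
- by exists graph.
- move=> g S gS [P [FP IP] PS]; have [x [Qx Px]] := IF _ _ IP FP.
  by exists (x, e x); split; [exact: gS | exact: PS].
(* The filter contains the graph, so its second projection is the image of
   its first one. *)
have HE : snd @ H = e @ (fst @ H).
  have Hg : H graph by apply: gH.
  have HgI S : H S -> H (graph `&` S) by exact: filterI.
  apply/seteqP; split=> S /HgI HS.
  - by apply: (@filterS _ H _ _ (fst @^-1` (e @^-1` S))) HS => -[u v] []; rewrite /graph /= => <-.
  - by apply: (@filterS _ H _ _ (snd @^-1` S)) HS => -[u v] []; rewrite /graph /= => ->.
rewrite HE in Hy; have [N [_ farN] NH] := limW _ _ (fmap_proper_filter fst PH) By Hy.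
apply: farN; exists x; split=> //; exists (fst @ H) => //.
by split=> //; exact: fmap_proper_filter.
Qed.

(** The neighbourhood filter of a new point [y] with trace [N] on [X]. *)
Definition cone (Y : Type) (e : X -> Y) (y : Y) (N : set_system X) :
  set_system Y := principal_filter y `&` (e @ N).

Lemma class_cone (Y : Type) (e : X -> Y) (y : Y) (N : set_system X) :
  M X N -> M Y (cone e y N).
Proof.
move=> MN; apply: class_meet => //; first exact: class_globally.
exact: class_fmap M_comp MN.
Qed.

Lemma cone_proper (Y : Type) (e : X -> Y) (y : Y) (N : set_system X) :
  Filter N -> ProperFilter (cone e y N).
Proof.
move=> FN; split; first by case=> + _; apply.
split; first by split=> //; exact: filterT.
- by move=> S T [yS NS] [yT NT]; split=> [z zy|]; [split; [exact: yS|exact: yT]|exact: filterI].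
- by move=> S T ST [yS NS]; split=> [z zy|]; [exact/ST/yS|exact: filterS NS].
Qed.

(** Points of [X] are isolated, and the remote filters share the limit [None].
    Asking for a single remote filter below [H], rather than a finite infimum
    of them, is enough for the infimum axiom by [remote_meet]. *)
Definition collapse_clim (H : set_system (option X)) : set (option X) :=
  [set p | ProperFilter H /\
    if p is Some x then principal_filter (Some x) `<=` H
    else exists2 N, remote N & cone Some None N `<=` H].

(** The degenerate filter is remote, so the principal filter of [None]
    converges to [None]. *)
Lemma remote_setT : remote [set: set X].
Proof.
split; first exact: fclass_degenerate.
by move=> [x [[G [PG TG] _] _]]; apply: (@filter_not_empty _ G); exact: TG.
Qed.

Lemma remote_meet (N P : set_system X) : remote N -> remote P -> remote (N `&` P).
Proof.
move=> [MN farN] [MP farP]; split; first exact: class_meet.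
have FN := fclass_filter MN; have FP := fclass_filter MP.
move=> [x [adhNP Ax]]; have [adhx|adhx] := adh_meet FN FP adhNP.
- by apply: farN; exists x.
- by apply: farP; exists x.
Qed.

Lemma collapse_clim_proper H p : collapse_clim H p -> ProperFilter H.
Proof. by case. Qed.

Lemma collapse_clim_finer G H : ProperFilter G -> ProperFilter H ->
  G `<=` H -> collapse_clim G `<=` collapse_clim H.
Proof.
move=> PG PH GH [x|] [_ Gp]; split=> //; first exact: subset_trans GH.
by have [N rN NG] := Gp; exists N => //; exact: subset_trans GH.
Qed.

Lemma collapse_clim_point p : collapse_clim (principal_filter p) p.
Proof.
split; first exact: principal_filter_proper.
by case: p => [x //|]; exists setT; [exact: remote_setT | move=> S []].
Qed.

Lemma collapse_clim_meet G H :
  collapse_clim G `&` collapse_clim H `<=` collapse_clim (G `&` H).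
Proof.
move=> p [[PG Gp] [PH Hp]]; split.
  split; first by case=> /filter_not_empty.
  split; first by split; exact: filterT.
  - by move=> S T [? ?] [? ?]; split; exact: filterI.
  - by move=> S T ST [? ?]; split; exact: filterS ST _.
case: p Gp Hp => [x Gx Hx S xS|[N rN NG] [P rP PH']].
  by split; [exact: Gx|exact: Hx].
exists (N `&` P); first exact: remote_meet.
by move=> S [pS [NS PS]]; split; [apply: NG|apply: PH'].
Qed.

Definition collapse : convergence (option X) :=
  Convergence collapse_clim_proper collapse_clim_finer
    collapse_clim_point collapse_clim_meet.

Lemma collapse_based : based collapse (M (option X)).
Proof.
move=> H [x|] [PH Hp].
  exists (principal_filter (Some x)); split=> //; first exact: class_globally.
  exact: collapse_clim_point.
have [N rN NH] := Hp; exists (cone Some None N); split=> //.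
  by apply: class_cone; case: rN.
split; last by exists N.
by apply: cone_proper; case: rN => /fclass_filter.
Qed.

Lemma compactly_mesh_of_collapse :
  (forall G, J (option X) G -> compact_at collapse (D (option X)) G [set None] ->
    compact_at (prod_convergence xi collapse) (@principal_filters (X * option X))
      (filter_prod F G) (A `*` [set None])) ->
  compactly_mesh xi (M X) (J X) (D X) F A.
Proof.
apply: (@compactly_mesh_of_test _ _ _ Some) => [N PN rN|W _ PW -> [_ [N rN NW]]].
  by exists None => //; split; [exact: fmap_proper_filter | exists N => // S []].
exists N => // S NS.
suff : (Some @ W) [set p | if p is Some x then S x else True] by [].
by apply: NW; split=> // _ ->.
Qed.

(** Points of [X] are isolated, and each remote filter has its own limit.
    Splitting [None] in this way turns the convergence above into a topology:
    each point has one neighbourhood filter. *)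
Definition fan : Type := (X + {N : set_system X | remote N})%type.

HB.instance Definition _ := gen_eqMixin fan.
HB.instance Definition _ := gen_choiceMixin fan.

Definition fan_nbhs (p : fan) : set_system fan :=
  match p with
  | inl x => principal_filter (inl x)
  | inr N => cone inl (inr N) (sval N)
  end.

HB.instance Definition _ := hasNbhs.Build fan fan_nbhs.

Lemma fan_nbhs_proper (p : fan) : ProperFilter (nbhs p).
Proof.
case: p => [x|[N rN]]; first exact: principal_filter_proper.
exact: (@cone_proper _ inl _ N (fclass_filter (proj1 rN))).
Qed.

Lemma fan_nbhs_singleton (p : fan) (S : set fan) : nbhs p S -> S p.
Proof. by case: p => [x xS|N [NS _]]; [exact: xS|exact: NS]. Qed.

Lemma fan_nbhs_nbhs (p : fan) (S : set fan) : nbhs p S -> nbhs p (nbhs^~ S).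
Proof.
case: p => [x xS|[N rN] [pS NS]]; first by move=> _ ->.
split; first by move=> _ ->.
have FN := fclass_filter (proj1 rN).
apply: (@filterS _ N _ (inl @^-1` S)) NS => x Sx; exact/principal_filterP.
Qed.

HB.instance Definition _ := Nbhs_isNbhsTopological.Build fan
  fan_nbhs_proper fan_nbhs_singleton fan_nbhs_nbhs.

Lemma fan_based : based (top_convergence fan) (M fan).
Proof.
move=> H p [PH Hp]; exists (nbhs p); split=> //; last first.
  by split=> //; exact: fan_nbhs_proper.
case: p {Hp} => [x|[N [MN rN]]]; first exact: class_globally.
exact: class_cone.
Qed.

Lemma compactly_mesh_of_fan :
  (forall (B : set fan) G, J fan G ->
    compact_at (top_convergence fan) (D fan) G B ->
    compact_at (prod_convergence xi (top_convergence fan))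
      (@principal_filters (X * fan)) (filter_prod F G) (A `*` B)) ->
  compactly_mesh xi (M X) (J X) (D X) F A.
Proof.
move=> prodc.
apply: (@compactly_mesh_of_test _ _ (range inr) inl _ _ (prodc _)).
- move=> N PN rN; exists (inr (exist _ N rN)); first by exists (exist _ N rN).
  by split; [exact: fmap_proper_filter | move=> S []].
- move=> W y PW [[N rN] _ <-] [_ NW]; exists N => // S NS.
  suff : (inl @ W) [set p : fan | if p is inl x then S x else True] by [].
  by apply: NW; split=> // _ ->.
Qed.

End TestSpaces.

(** * Products of compactly meshing filters *)

(** Two exchanges: [F] is used first to find [C], and [G] then has to mesh
    with [E(C)], which is why [I] is required to be finer than [G]. *)
Lemma compactly_mesh_prod (D M J K : filterClass)
    (D_comp : composable D D) (M_comp : composable M M)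
    (D_princ : contains_principal D) (M_princ : contains_principal M)
    (J_comp : composable D J) (K_comp : composable D K)
    (X Y : Type) (xi : convergence X) (tau : convergence Y)
    (F : set_system X) (G : set_system Y) (A : set X) (B : set Y) :
  K X F -> compactly_mesh xi (M X) (J X) (D X) F A ->
  mesh_finer (K Y) (J Y) G ->
  compactly_mesh tau (@all_filters Y) (D Y) (M Y) G B ->
  compactly_mesh (prod_convergence xi tau) (M (X * Y)%type) (D (X * Y)%type)
    (product_filters (D X) (M Y)) (filter_prod F G) (A `*` B).
Proof.
move=> KF Fc Gf Gc E DE EFG; have FE := fclass_filter DE.
have [I [JI IE GI]] : exists I, [/\ J Y I, I `#` filter_rel_image E F & G `<=` I].
  by apply: Gf; [exact: K_comp _ _ _ _ KF DE | exact/meets_filter_rel_image].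
have [|C [DC CE Cc]] := Fc _ (class_rel_image_swap D_princ D_comp J_comp DE JI).
  by apply/meets_filter_rel_image_swap/meets_filter_rel_image; rewrite meetsC.
have ECI : E `#` filter_prod C I.
  by apply/meets_filter_rel_image_swap; rewrite meetsC.
have [|N [MN NE Nc]] := Gc _ (D_comp _ _ _ _ DC DE).
  exact: meetsSr GI (proj2 (meets_filter_rel_image _ _ _) ECI).
exists (filter_prod C N); split; first by exists C => //; exists N.
  by rewrite meetsC; apply/meets_filter_rel_image; rewrite meetsC.
exact: compact_at_prod.
Qed.

(** * The equivalence *)

Theorem theorem26 (D M J K : filterClass)
    (D_comp : composable D D) (M_comp : composable M M)
    (D_princ : contains_principal D) (M_princ : contains_principal M)
    (J_comp : composable D J) (K_comp : composable D K)
    (X : Type) (xi : convergence X) (F : set_system X) (KF : K X F)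
    (A : set X) :
  [<->
    (* 1 *)
    compactly_mesh xi (M X) (J X) (D X) F A;
    (* 2 *)
    forall (Y : Type) (tau : convergence Y) (B : set Y) (G : set_system Y),
      Filter G ->
      mesh_finer (K Y) (J Y) G ->
      compactly_mesh tau (@all_filters Y) (D Y) (M Y) G B ->
      compactly_mesh (prod_convergence xi tau) (M (X * Y)%type)
        (D (X * Y)%type) (product_filters (D X) (M Y))
        (filter_prod F G) (A `*` B);
    (* 3 *)
    forall (Y : Type) (tau : convergence Y),
      accessible tau (D Y) (M Y) ->
      forall (B : set Y) (G : set_system Y),
      J Y G -> compact_at tau (D Y) G B ->
      compact_at (prod_convergence xi tau)
        (D (X * Y)%type `&` M (X * Y)%type) (filter_prod F G) (A `*` B);
    (* 4 *)
    forall (Y : Type) (tau : convergence Y),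
      based tau (M Y) ->
      forall (y : Y) (G : set_system Y),
      J Y G -> compact_at tau (D Y) G [set y] ->
      compact_at (prod_convergence xi tau)
        (@principal_filters (X * Y)) (filter_prod F G) (A `*` [set y]);
    (* 5 *)
    forall Y : topologicalType,
      based (top_convergence Y) (M Y) ->
      forall (B : set Y) (G : set_system Y),
      J Y G -> compact_at (top_convergence Y) (D Y) G B ->
      compact_at (prod_convergence xi (top_convergence Y))
        (@principal_filters (X * Y)) (filter_prod F G) (A `*` B)].
Proof.
tfae.
- by move=> Fc Y tau B G _; apply: compactly_mesh_prod Fc.
- move=> h2 Y tau acc B G JG Gc.
  apply: compactly_mesh_compact.
  apply: h2 (mesh_finer_self _) (adherent_compactly_mesh acc Gc) => //.
  exact: fclass_filter JG.
- move=> h3 Y tau btau y G JG Gc E PE.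
  apply: h3 (based_accessible btau) _ _ JG Gc _ _.
  by split; [exact: D_princ|exact: M_princ].
- move=> h4 Y btau B G JG Gc E PE.
  (* Through (1), which the space with one new point provides. *)
  have Fc : compactly_mesh xi (M X) (J X) (D X) F A.
    apply: compactly_mesh_of_collapse => // H.
    by apply: h4; exact: collapse_based.
  have FGc := compactly_mesh_prod D_comp M_comp D_princ M_princ J_comp K_comp
    KF Fc (mesh_finer_self JG)
    (adherent_compactly_mesh (based_accessible btau) Gc).
  by apply: compactly_mesh_compact FGc _ _; split;
    [exact: D_princ|exact: M_princ].
- move=> h5; apply: compactly_mesh_of_fan => //.
  by apply: h5; exact: fan_based.
Qed.
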